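(* Let $p$ be an odd prime, $q\in\mathbb{C}_p$ with $|q-1|_p<1$, $h\in\mathbb{Z}$ and $\zeta\in T_p$. For every $n\in\mathbb{Z}_+$, $$q^{h-1}\zeta\int_{\mathbb{Z}_p}[1-x]_{q^{-1}}^n\,q^{(h-1)x}\zeta^x\,d\mu_{-q}(x)=E^{(h)}_{n,q^{-1},\zeta^{-1}}(2).$$
   Context: $\mathbb{Z}_p$, $\mathbb{C}_p$ denote the $p$-adic integers and the completion of the algebraic closure of $\mathbb{Q}_p$; $\mathbb{Z}_+=\{0,1,2,\dots\}$. $T_p=\bigcup_{n\ge1}\{\zeta\in\mathbb{C}_p:\zeta^{p^n}=1\}$; for $\zeta\in T_p$ and $y\in\mathbb{Z}_p$, $\zeta^y$ is defined by continuity. For $Q\in\mathbb{C}_p$ with $|Q-1|_p<1$ (applied to $Q=q$ and $Q=q^{-1}$), $[x]_Q=\frac{1-Q^x}{1-Q}$, and for uniformly differentiable $f:\mathbb{Z}_p\to\mathbb{C}_p$, $\int_{\mathbb{Z}_p}f(x)\,d\mu_{-Q}(x)=\lim_{N\to\infty}\frac{1+Q}{1+Q^{p^N}}\sum_{x=0}^{p^N-1}f(x)(-Q)^x$. For $\xi\in T_p$, the twisted $(h,Q)$-Euler polynomials are $E^{(h)}_{n,Q,\xi}(x)=\int_{\mathbb{Z}_p}[x+y]_Q^n\xi^y Q^{(h-1)y}\,d\mu_{-Q}(y)$. *)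

(* Defs.v *)
From HB Require Import structures.
From mathcomp Require Import all_boot all_order all_algebra.
From mathcomp Require Import all_classical all_reals all_analysis.

Set Implicit Arguments.
Unset Strict Implicit.
Unset Printing Implicit Defensive.

Import Order.TTheory GRing.Theory Num.Theory.

Local Open Scope classical_set_scope.
Local Open Scope ring_scope.

(* Fields with a non-archimedean absolute value.  The library's               *)
(* normedZmodType is not usable here: its axiom `|x *+ n| = `|x| *+ n forces  *)
(* the norm to be archimedean.                                                *)
HB.mixin Record Field_isUltravalued (R : realType) K & GRing.Field K := {
  vabs : K -> R ;
  vabs_ge0 : forall x, 0 <= vabs x ;
  vabs_eq0 : forall x, (vabs x == 0) = (x == 0) ;
  vabsM : forall x y, vabs (x * y) = vabs x * vabs y ;
  vabsD_max : forall x y, vabs (x + y) <= Num.max (vabs x) (vabs y)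
}.

#[short(type="ultravaluedFieldType")]
HB.structure Definition UltravaluedField (R : realType) :=
  { K of GRing.Field K & Field_isUltravalued R K }.

Section UltravaluedTheory.
Context (R : realType) (K : ultravaluedFieldType R).
Local Notation vabs := (@vabs R K).

Lemma vabs0 : vabs 0 = 0.
Proof. by apply/eqP; rewrite vabs_eq0. Qed.

Lemma vabs1 : vabs 1 = 1.
Proof.
have n0 : vabs 1 != 0 by rewrite vabs_eq0 oner_eq0.
by apply: (mulfI n0); rewrite -vabsM !mulr1.
Qed.

Lemma vabsN x : vabs (- x) = vabs x.
Proof.
rewrite -mulN1r vabsM -[RHS]mul1r; congr (_ * _); apply/eqP.
by rewrite -(@eqrXn2 _ 2) ?vabs_ge0// expr1n expr2 -vabsM mulrNN mulr1 vabs1.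
Qed.

Definition vdist (x y : K) : R := vabs (x - y).

Fact vdistxx x : vdist x x = 0.
Proof. by rewrite /vdist subrr vabs0. Qed.

Fact vdist_positivity x y : vdist x y = 0 -> x = y.
Proof. by move/eqP; rewrite vabs_eq0 subr_eq0 => /eqP. Qed.

Fact vdist_sym x y : vdist x y = vdist y x.
Proof. by rewrite /vdist -vabsN opprB. Qed.

Fact vdist_triangle y x z : vdist x z <= vdist x y + vdist y z.
Proof.
rewrite /vdist; have -> : x - z = (x - y) + (y - z) by rewrite subrKA.
by rewrite (le_trans (vabsD_max _ _))// ge_max lerDl lerDr !vabs_ge0.
Qed.

Definition vball_pred : {pred K} := [pred x | vabs x <= 1].

Fact vball_subring : subring_closed vball_pred.
Proof.
split=> [|x y|x y]; rewrite !inE ?vabs1// => x1 y1.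
  by rewrite (le_trans (vabsD_max _ _))// ge_max x1 vabsN.
by rewrite vabsM mulr_ile1// vabs_ge0.
Qed.
HB.instance Definition _ := GRing.isSubringClosed.Build K vball_pred vball_subring.

End UltravaluedTheory.

#[non_forgetful_inheritance]
HB.instance Definition _ (R : realType) (K : ultravaluedFieldType R) :=
  isPointed.Build (UltravaluedField.sort K) 0.
#[non_forgetful_inheritance]
HB.instance Definition _ (R : realType) (K : ultravaluedFieldType R) :=
  isMetric.Build R (UltravaluedField.sort K)
    (@vdistxx R K) (@vdist_positivity R K) (@vdist_sym R K)
    (@vdist_triangle R K).

Definition padic_abs (R : realType) (p : nat) (x : rat) : R :=
  if x == 0 then 0
  else p%:R ^ ((logn p `|denq x|%N)%:Z - (logn p `|numq x|%N)%:Z).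

Record is_completion (R : realType) (K : fieldType) (v : K -> R)
    (L : ultravaluedFieldType R) (i : {rmorphism K -> L}) : Prop := {
  completion_isometry : forall x, vabs (i x) = v x ;
  completion_dense : dense (range i) ;
  completion_complete :
    forall F : set_system L, ProperFilter F -> cauchy F -> cvg F
}.

Record is_valued_algebraic_closure (R : realType)
    (K L : ultravaluedFieldType R) (i : {rmorphism K -> L}) : Prop := {
  alg_closure_closed : GRing.closed_field_axiom L ;
  alg_closure_algebraic : forall x, algebraicOver i x ;
  alg_closure_isometry : forall x, vabs (i x) = vabs x
}.

(* A model of the tower Q -> Q_p -> \bar{Q_p} -> C_p.  Each step is           *)
(* determined by the previous one up to isometric isomorphism, since the      *)
(* absolute value of the complete field Q_p extends uniquely to \bar{Q_p}.    *)
Record padic_tower (R : realType) (p : nat) := PadicTower {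
  Qp : ultravaluedFieldType R ;
  rat_to_Qp : {rmorphism rat -> Qp} ;
  Qp_completion : is_completion (padic_abs R p) rat_to_Qp ;
  Qpbar : ultravaluedFieldType R ;
  Qp_to_Qpbar : {rmorphism Qp -> Qpbar} ;
  Qpbar_alg_closure : is_valued_algebraic_closure Qp_to_Qpbar ;
  Cp : ultravaluedFieldType R ;
  Qpbar_to_Cp : {rmorphism Qpbar -> Cp} ;
  Cp_completion : is_completion (@vabs R Qpbar) Qpbar_to_Cp
}.

Section PadicIntegers.
Context (R : realType) (p : nat) (C : padic_tower R p).

Record padic_int := PadicInt { padic_int_val :> Qp C ; _ : padic_int_val \in @vball_pred R (Qp C) }.

HB.instance Definition _ := [isSub for padic_int_val].
HB.instance Definition _ := [Choice of padic_int by <:].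
HB.instance Definition _ := [SubChoice_isSubComNzRing of padic_int by <:].

Definition padic_int_to_Cp (x : padic_int) : Cp C := Qpbar_to_Cp C (Qp_to_Qpbar C (padic_int_val x)).

(* The traces on nat of the neighbourhoods of x. *)
Definition nat_near (x : padic_int) : set_system nat :=
  filter_from (nbhs (padic_int_val x)) (fun U => [set k : nat | U k%:R]).

(* a ^ x by continuity: the limit of a ^+ k as k : nat tends to x p-adically. *)
Definition padic_pow (a : Cp C) (x : padic_int) : Cp C :=
  lim (a ^+ k @[k --> nat_near x]).

Definition Tp : set (Cp C) :=
  \bigcup_(n in [set n | (1 <= n)%N]) [set z | z ^+ (p ^ n) = 1].

(* At Q = 1 the quotient is 0 / 0; its conventional value is the limit x.     *)
Definition qnum (Q : Cp C) (x : padic_int) : Cp C :=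
  if Q == 1 then padic_int_to_Cp x else (1 - padic_pow Q x) / (1 - Q).

Definition fermionic_integral (Q : Cp C) (f : padic_int -> Cp C) : Cp C :=
  lim ((1 + Q) / (1 + Q ^+ (p ^ N)) *
         (\sum_(0 <= x < p ^ N) f x%:R * (- Q) ^+ x) @[N --> \oo]).

Definition twisted_Euler (h : int) (n : nat) (Q xi : Cp C) (x : padic_int) : Cp C :=
  fermionic_integral Q (fun y =>
    qnum Q (x + y) ^+ n * padic_pow xi y * padic_pow Q ((h - 1)%:~R * y)).

End PadicIntegers.

Arguments padic_int {R p} C.
Arguments Tp {R p} C _.

(* Main.v *)
(* Reversing the order of summation, x = p^N - 1 - y, turns the N-th Riemann
   sum on the left, multiplied by q^(h-1) zeta, into the N-th sum on the right
   with [2 + y] replaced by [2 + y - p^N] and an extra factor q^((h-1) p^N), as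
   soon as zeta^(p^N) = 1.  Both perturbations vanish uniformly in y as N grows,
   because q^(p^N) --> 1.  So the two sequences have the same limits; their
   convergence is never needed, because the limit of a divergent sequence is the
   default value 0, which is also preserved by scaling. *)
Require Import Defs.
From mathcomp Require Import all_boot all_order all_algebra.
From mathcomp Require Import all_classical all_reals all_analysis.
From mathcomp Require Import ring.

Set Implicit Arguments.
Unset Strict Implicit.
Unset Printing Implicit Defensive.

Import Order.TTheory GRing.Theory Num.Theory.

Local Open Scope classical_set_scope.
Local Open Scope ring_scope.

(** * Ultrametric estimates and limits in a field with a non-archimedean absolute value *)

Section Ultravalued.
Context (R : realType) (K : ultravaluedFieldType R).
Implicit Types (x y a b : K) (e : R).

Lemma vabsD_le x y e : vabs x <= e -> vabs y <= e -> vabs (x + y) <= e.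
Proof. by move=> xe ye; rewrite (le_trans (vabsD_max _ _))// ge_max xe. Qed.

Lemma vabsD_lt x y e : vabs x < e -> vabs y < e -> vabs (x + y) < e.
Proof. by move=> xe ye; rewrite (le_lt_trans (vabsD_max _ _))// gt_max xe. Qed.

Lemma vabs_sum_le (I : Type) (r : seq I) (P : pred I) (F : I -> K) e :
  0 <= e -> (forall i, P i -> vabs (F i) <= e) ->
  vabs (\sum_(i <- r | P i) F i) <= e.
Proof.
by move=> e0 Fe; elim/big_ind: _ => //; [rewrite vabs0 | move=> x y; exact: vabsD_le].
Qed.

Lemma vabsX x n : vabs (x ^+ n) = vabs x ^+ n.
Proof. by elim: n => [|n IHn]; rewrite ?expr0 ?vabs1// !exprS vabsM IHn. Qed.

Lemma vabsV x : vabs x^-1 = (vabs x)^-1.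
Proof.
have [->|x0] := eqVneq x 0; first by rewrite invr0 vabs0 invr0.
have vx0 : vabs x != 0 by rewrite vabs_eq0.
by apply: (mulfI vx0); rewrite -vabsM !divff ?vabs1.
Qed.

Lemma vabs_distC x y : vabs (x - y) = vabs (y - x).
Proof. by rewrite -vabsN opprB. Qed.

Lemma vabs_eq1_neq0 a : vabs a = 1 -> a != 0.
Proof. by move=> a1; rewrite -vabs_eq0 a1 oner_eq0. Qed.

Lemma vabsXz_eq1 a (m : int) : vabs a = 1 -> vabs (a ^ m) = 1.
Proof.
by move=> a1; case: m => n; rewrite ?vabsV vabsX a1 expr1n ?invr1.
Qed.

Lemma vabsX_eq1 a n : vabs a = 1 -> vabs (a ^+ n) = 1.
Proof. by move=> a1; rewrite vabsX a1 expr1n. Qed.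

(** Writing x = (x + y) - y bounds |x| by the larger of |x + y| and |y|, and |y| is too small to be
    that bound. *)
Lemma vabsDl_eq x y : vabs y < vabs x -> vabs (x + y) = vabs x.
Proof.
move=> yx; apply/eqP; rewrite eq_le vabsD_le ?(ltW yx)//=.
have := vabsD_max (x + y) (- y); rewrite addrK vabsN le_max => /orP[//|].
by rewrite leNgt yx.
Qed.

Lemma vabs_one_unit a : vabs (a - 1) < 1 -> vabs a = 1.
Proof.
by move=> a1; rewrite -[a](subrK 1) addrC vabsDl_eq ?vabs1.
Qed.

Lemma vabs_natr_le1 n : vabs (n%:R : K) <= 1.
Proof.
elim: n => [|n IHn]; first by rewrite vabs0.
by rewrite -natr1 vabsD_le ?vabs1.
Qed.

Lemma vabs_intr_le1 (m : int) : vabs (m%:~R : K) <= 1.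
Proof. by case: m => n; rewrite ?NegzE ?mulrNz ?vabsN vabs_natr_le1. Qed.

Lemma vabs_subX_le x y n :
  vabs x <= 1 -> vabs y <= 1 -> vabs (x ^+ n - y ^+ n) <= vabs (x - y).
Proof.
move=> x1 y1; rewrite subrXX vabsM ler_piMr ?vabs_ge0//.
apply: vabs_sum_le => // i _.
by rewrite vabsM !vabsX mulr_ile1 ?exprn_ge0 ?vabs_ge0// exprn_ile1 ?vabs_ge0.
Qed.

(** Negative exponents reduce to natural ones through a^(-n) - 1 = a^(-n) (1 - a^n), where |a^(-n)|
    = 1. *)
Lemma vabs_expz_sub1_le a (m : int) :
  vabs a = 1 -> vabs (a ^ m - 1) <= vabs (a - 1).
Proof.
move=> a1; have h n : vabs (a ^+ n - 1) <= vabs (a - 1).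
  by have := @vabs_subX_le a 1 n; rewrite expr1n a1 vabs1; apply.
case: m => n; first exact: h.
have an0 : a ^+ n.+1 != 0 by rewrite vabs_eq1_neq0// vabsX_eq1.
rewrite (_ : a ^ Negz n - 1 = (a ^+ n.+1)^-1 * (1 - a ^+ n.+1)).
  by rewrite vabsM vabsV vabsX_eq1// invr1 mul1r vabs_distC.
by rewrite mulrBr mulr1 mulVf.
Qed.

Lemma cvg_vabsP (T : Type) (F : set_system T) {FF : Filter F} (f : T -> K) (l : K) :
  f t @[t --> F] --> l <->
  forall e, 0 < e -> \forall t \near F, vabs (l - f t) < e.
Proof.
split=> [/cvg_ballP fl e /fl|fl]; first by rewrite ballEmdist.
by apply/cvg_ballP => e /fl; rewrite ballEmdist.
Qed.

(** [lim] picks a point from the set of limits. A vanishing difference makes the two sets equal, so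
    the choices agree even when both sets are empty. *)
Lemma eq_lim_vabs (u v : nat -> K) :
  (forall e, 0 < e -> \forall N \near \oo, vabs (u N - v N) < e) ->
  lim (u N @[N --> \oo]) = lim (v N @[N --> \oo]).
Proof.
move=> uv; congr (get _); apply/funext => l; apply/propext.
split=> /cvg_vabsP h; apply/cvg_vabsP => e e0; near=> N.
  have -> : l - v N = (l - u N) + (u N - v N) by rewrite subrKA.
  by apply: vabsD_lt; near: N; [exact: h | exact: uv].
have -> : l - u N = (l - v N) + (v N - u N) by rewrite subrKA.
by apply: vabsD_lt; [|rewrite vabs_distC]; near: N; [exact: h | exact: uv].
Unshelve. all: by end_near. Qed.

Lemma cvgMl_vabs (c : K) (u : nat -> K) (l : K) : c != 0 ->
  u N @[N --> \oo] --> l -> c * u N @[N --> \oo] --> c * l.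
Proof.
move=> c0 /cvg_vabsP ul; have vc : 0 < vabs c by rewrite lt0r vabs_eq0 c0 vabs_ge0.
apply/cvg_vabsP => e e0; near=> N.
rewrite -mulrBr vabsM mulrC -ltr_pdivlMr//; near: N.
by apply: ul; rewrite divr_gt0.
Unshelve. all: by end_near. Qed.

Lemma ultravalued_hausdorff : hausdorff_space K.
Proof. exact: metric_hausdorff. Qed.

(* No convergence is assumed: without it both limits are the junk value [point = 0]. *)
Lemma limMl_vabs (c : K) (u : nat -> K) : c != 0 ->
  lim (c * u N @[N --> \oo]) = c * lim (u N @[N --> \oo]).
Proof.
move=> c0; have [/cvg_ex[l ul]|nu] := pselect (cvg (u N @[N --> \oo])).
  rewrite (cvg_lim ultravalued_hausdorff ul).
  exact: (cvg_lim ultravalued_hausdorff (cvgMl_vabs c0 ul)).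
have ncu : ~ cvg (c * u N @[N --> \oo]).
  move=> /cvg_ex[l cul]; apply: nu; apply/cvg_ex; exists (c^-1 * l).
  have := cvgMl_vabs (invr_neq0 c0) cul.
  by under eq_fun do rewrite mulKf//.
by rewrite (dvgP nu) (dvgP ncu) mulr0.
Qed.

End Ultravalued.

Lemma near_expr_lt (R : realType) (r e : R) : 0 <= r -> r < 1 -> 0 < e ->
  \forall N \near \oo, r ^+ N < e.
Proof.
move=> r0 r1 e0; have /cvg_expr/cvgr0Pnorm_lt/(_ e e0) : `|r| < 1 by rewrite ger0_norm.
by apply: filterS => N; rewrite ger0_norm ?exprn_ge0.
Qed.

(** * Convergence of iterated [p]-th powers to 1 *)

Section PowersOfOneUnits.
Context (R : realType) (K : ultravaluedFieldType R) (p : nat).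
Implicit Types (a : K) (r : R).

(** The cofactor 1 + a + ... + a^(p-1) of a - 1 is congruent to p modulo a - 1, hence bounded by
    [r]. *)
Lemma vabs_exp_sub1_le a r : vabs (p%:R : K) <= r -> vabs (a - 1) <= r ->
  r <= 1 -> vabs a = 1 -> vabs (a ^+ p - 1) <= r * vabs (a - 1).
Proof.
move=> pr ar r1 a1; rewrite subrX1 vabsM mulrC ler_wpM2r ?vabs_ge0//.
have -> : \sum_(i < p) a ^+ i = p%:R + \sum_(i < p) (a ^+ i - 1).
  by rewrite sumrB big_const_ord iter_addr_0 addrC subrK.
rewrite vabsD_le// vabs_sum_le// => [|i _]; first by rewrite (le_trans _ ar) ?vabs_ge0.
exact: le_trans (vabs_expz_sub1_le i a1) ar.
Qed.

Lemma cvg_one_unit_expp a : vabs (p%:R : K) < 1 -> vabs (a - 1) < 1 ->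
  a ^+ (p ^ N) @[N --> \oo] --> (1 : K).
Proof.
move=> p1 a1; pose r := Num.max (vabs (p%:R : K)) (vabs (a - 1)).
have pr : vabs (p%:R : K) <= r by rewrite le_max lexx.
have ar : vabs (a - 1) <= r by rewrite le_max lexx orbT.
have r1 : r < 1 by rewrite gt_max p1.
have r0 : 0 <= r by rewrite (le_trans _ ar) ?vabs_ge0.
have va : vabs a = 1 by exact: vabs_one_unit.
have bound N : vabs (a ^+ (p ^ N) - 1) <= r ^+ N * vabs (a - 1).
  elim: N => [|N IHN]; first by rewrite expr1 mul1r.
  rewrite expnSr exprM exprS -mulrA.
  (* The iterate is still within [r] of 1, so the next [p]-th power contracts by the same ratio
     [r]. *)
  have h := le_trans IHN (ler_piMl (vabs_ge0 _) (exprn_ile1 _ r0 (ltW r1))).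
  rewrite (le_trans (vabs_exp_sub1_le pr (le_trans h ar) (ltW r1) _))//.
    exact: vabsX_eq1.
  by rewrite ler_wpM2l.
apply/cvg_vabsP => e e0.
apply: filterS (near_expr_lt r0 r1 e0) => N rN.
rewrite vabs_distC (le_lt_trans (bound N))// (le_lt_trans _ rN)//.
by rewrite ler_piMr ?exprn_ge0// ltW.
Qed.

(** Some a^(p^N) is a one-unit, so |a|^(p^N) = 1 with |a| a nonnegative real. The convergence
    hypothesis covers one-units and p-power roots of unity alike. *)
Lemma cvg_expp_vabs1 a : prime p -> a ^+ (p ^ N) @[N --> \oo] --> (1 : K) ->
  vabs a = 1.
Proof.
move=> pp /cvg_vabsP/(_ 1 ltr01)[N _ /(_ N (leqnn N))] /=.
rewrite vabs_distC => /vabs_one_unit; rewrite vabsX => /eqP.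
by rewrite pexpr_eq1 ?expn_gt0 ?prime_gt0 ?vabs_ge0// => /eqP.
Qed.

Lemma cvg_expp_inv a : prime p -> a ^+ (p ^ N) @[N --> \oo] --> (1 : K) ->
  a^-1 ^+ (p ^ N) @[N --> \oo] --> (1 : K).
Proof.
move=> pp a1; have va := cvg_expp_vabs1 pp a1.
apply/cvg_vabsP => e e0; move/cvg_vabsP/(_ e e0): a1.
apply: filterS => N; apply: le_lt_trans.
rewrite exprVn -exprN1 vabs_distC [leRHS]vabs_distC.
by apply: vabs_expz_sub1_le; exact: vabsX_eq1.
Qed.

End PowersOfOneUnits.

(** * Integers in the p-adic tower and powers with integer p-adic exponents *)

Section PadicTower.
Context (R : realType) (p : nat) (C : padic_tower R p).
Implicit Types (a Q : Cp C) (m : int).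

Lemma vabs_intr_Qp m : vabs (m%:~R : Qp C) = padic_abs R p m%:~R.
Proof.
by rewrite -(completion_isometry (Qp_completion C)) rmorph_int.
Qed.

Lemma vabs_intr_Cp m : vabs (m%:~R : Cp C) = padic_abs R p m%:~R.
Proof.
rewrite -vabs_intr_Qp -(alg_closure_isometry (Qpbar_alg_closure C)) rmorph_int.
by rewrite -(completion_isometry (Cp_completion C)) rmorph_int.
Qed.

Lemma padic_abs_intr m :
  padic_abs R p m%:~R = if m == 0 then 0 else p%:R ^- logn p `|m|%N.
Proof.
rewrite /padic_abs intr_eq0 numq_int denq_int logn1 sub0r.
by case: eqP => // _; rewrite -exprnN.
Qed.

Hypothesis p_prime : prime p.

Lemma padic_abs_prime : padic_abs R p p%:~R = p%:R^-1.
Proof.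
rewrite padic_abs_intr eqz_nat -leqn0 leqNgt prime_gt0//=.
by rewrite logn_prime// eqxx expr1.
Qed.

Lemma padic_abs_prime_lt1 : padic_abs R p p%:~R < 1.
Proof.
by rewrite padic_abs_prime invf_lt1 ?ltr1n ?prime_gt1// ltr0n prime_gt0.
Qed.

Lemma dvdz_padic_abs m N : padic_abs R p m%:~R < p%:R ^- N -> ((p ^ N)%N %| m)%Z.
Proof.
rewrite padic_abs_intr; case: eqVneq => [->//|m0].
rewrite ltf_pV2 ?posrE ?exprn_gt0 ?ltr0n ?prime_gt0//.
rewrite -!natrX ltr_nat ltn_exp2l ?prime_gt1// => Nm.
by rewrite dvdzE/= pfactor_dvdn ?absz_gt0// ltnW.
Qed.

Lemma padic_int_valz m : padic_int_val (m%:~R : padic_int C) = m%:~R.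
Proof. exact: (rmorph_int (val : {rmorphism padic_int C -> Qp C})). Qed.

Lemma padic_int_to_Cpz m : padic_int_to_Cp (m%:~R : padic_int C) = m%:~R.
Proof. by rewrite /padic_int_to_Cp padic_int_valz !rmorph_int. Qed.

(** Every p-adic neighbourhood of an integer, even a negative one, contains natural numbers.
    Properness makes the limit in [padic_pow] unique. *)
Lemma nat_near_filter m : ProperFilter (nat_near (m%:~R : padic_int C)).
Proof.
apply: filter_from_proper.
  apply: filter_from_filter; first by exists setT; exact: filterT.
  by move=> U V hU hV; exists (U `&` V) => //; exact: filterI.
move=> U; rewrite padic_int_valz => /nbhs_ballP[e /= e0 eU].
have [N Ne] : exists N, (p%:R : R)^-1 ^+ N < e.
  have [|||N _ /(_ N (leqnn N))] := @near_expr_lt R p%:R^-1 e; last by exists N.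
  - by rewrite invr_ge0.
  - by rewrite -padic_abs_prime padic_abs_prime_lt1.
  - by [].
(* This integer is congruent to m modulo p^N, and it is nonnegative because p^N >= 1. *)
exists (absz (m + `|m| * (p ^ N)%N%:Z)); apply: eU.
rewrite ballEmdist/=.
have m_ge0 : 0 <= m + `|m| * (p ^ N)%N%:Z.
  rewrite -lerBlDl sub0r (le_trans (_ : _ <= `|m|))//; last first.
    by rewrite ler_peMr// lez_nat expn_gt0 prime_gt0.
  by rewrite -normrN ler_norm.
rewrite /mdist/= /vdist pmulrn gez0_abs// -rmorphB/= opprD addNKr.
rewrite mulrNz vabsN intrM vabsM.
rewrite (le_lt_trans (ler_piMl _ (vabs_intr_le1 _ _))) ?vabs_ge0//.
by rewrite -pmulrn natrX vabsX pmulrn vabs_intr_Qp padic_abs_prime.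
Qed.

(** A natural k close to m differs from it by a multiple c p^N, and (a^(p^N))^c is close to 1. The
    Riemann sums thus reduce to ordinary integer powers. *)
Lemma padic_pow_int a m :
  a ^+ (p ^ N) @[N --> \oo] --> (1 : Cp C) ->
  padic_pow a (m%:~R : padic_int C) = a ^ m.
Proof.
move=> a1; have va := cvg_expp_vabs1 p_prime a1.
have FF := nat_near_filter m.
apply: (cvg_lim (@ultravalued_hausdorff R (Cp C))).
apply/cvg_vabsP => e e0.
have /cvg_vabsP/(_ e e0)[N _ /(_ N (leqnn N)) /= Ne] := a1.
have pN0 : 0 < (p%:R : R) ^- N by rewrite invr_gt0 exprn_gt0// ltr0n prime_gt0.
exists (ball (m%:~R : Qp C) (p%:R ^- N)).
  by rewrite padic_int_valz; exact: nbhsx_ballx.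
move=> k; rewrite /= ballEmdist/= /mdist/= /vdist.
rewrite pmulrn -rmorphB/= vabs_intr_Qp => /dvdz_padic_abs/dvdzP[c mk].
have -> : a ^ m - a ^+ k = a ^ k * ((a ^+ (p ^ N)) ^ c - 1).
  rewrite mulrBr mulr1 -[a ^+ (p ^ N)]/(a ^ (p ^ N)%N%:Z) exprz_exp.
  rewrite -expfzDr ?vabs_eq1_neq0//; congr (a ^ _ - _).
  by rewrite mulrC -mk addrC subrK.
rewrite vabsM vabsXz_eq1// mul1r (le_lt_trans (vabs_expz_sub1_le _ _)) ?vabsX_eq1//.
by rewrite vabs_distC.
Qed.

End PadicTower.

(** * The brackets [m]_Q at integers m *)

Section QNumbers.
Context (R : realType) (p : nat) (C : padic_tower R p).
Hypothesis p_prime : prime p.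
Context (Q : Cp C).
Hypothesis cvg_Q : Q ^+ (p ^ N) @[N --> \oo] --> (1 : Cp C).
Implicit Types m k : int.

Local Notation qint m := (qnum Q (m%:~R : padic_int C)).

Let vabs_Q : vabs Q = 1. Proof. exact: cvg_expp_vabs1 cvg_Q. Qed.

Lemma qnum_int m : qint m = if Q == 1 then m%:~R else (1 - Q ^ m) / (1 - Q).
Proof. by rewrite /qnum padic_int_to_Cpz padic_pow_int. Qed.

Lemma vabs_qnum_int_le1 m : vabs (qint m) <= 1.
Proof.
rewrite qnum_int; case: eqVneq => [_|Q1]; first exact: vabs_intr_le1.
have Q10 : 0 < vabs (1 - Q) by rewrite lt0r vabs_ge0 vabs_eq0 subr_eq0 eq_sym Q1.
rewrite vabsM vabsV ler_pdivrMr// mul1r vabs_distC [leRHS]vabs_distC.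
exact: vabs_expz_sub1_le.
Qed.

(** As |Q| = 1, shifting the argument by k costs exactly |[k]|; with k = p^N this compares the
    brackets of the two sums. *)
Lemma qnum_intB m k : qint (m - k) - qint m = - Q ^ (m - k) * qint k.
Proof.
rewrite !qnum_int; case: eqVneq => [->|Q1].
  by rewrite exp1rz mulN1r rmorphB/= addrAC subrr add0r.
rewrite -mulrBl mulrA; congr (_ / _).
have <- : Q ^ (m - k) * Q ^ k = Q ^ m by rewrite -expfzDr ?vabs_eq1_neq0// subrK.
ring.
Qed.

(** At Q = 1 the bracket is p^N, small because |p| < 1; otherwise its numerator 1 - Q^(p^N) tends to
    0 over a fixed denominator. *)
Lemma near_vabs_qnum_expp (e : R) : 0 < e ->
  \forall N \near \oo, vabs (qint (p ^ N)%N) < e.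
Proof.
move=> e0; have [Q1|Q1] := eqVneq Q 1.
  have p0 : 0 <= padic_abs R p p%:~R by rewrite -(vabs_intr_Cp C) vabs_ge0.
  apply: filterS (near_expr_lt p0 (padic_abs_prime_lt1 R p_prime) e0) => N pN.
  by rewrite qnum_int Q1 eqxx -pmulrn natrX vabsX pmulrn vabs_intr_Cp.
have Q10 : 0 < vabs (1 - Q) by rewrite lt0r vabs_ge0 vabs_eq0 subr_eq0 eq_sym Q1.
have := cvg_Q => /cvg_vabsP/(_ _ (mulr_gt0 e0 Q10)).
apply: filterS => N; rewrite qnum_int (negbTE Q1) vabsM vabsV.
by rewrite ltr_pdivrMr.
Qed.

End QNumbers.

(* The weight of the integrals under the substitution x = P - 1 - y; the sign
   survives because P - 1 is even. *)
Lemma reflect_weight (K : fieldType) (q z : K) (h : int) (P y : nat) :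
  q != 0 -> z ^+ P = 1 -> z != 0 -> odd P -> (y < P)%N ->
  1 + q ^+ P != 0 ->
  q ^ (h - 1) * z * ((1 + q) / (1 + q ^+ P) *
    (q ^ ((h - 1) * (P - y.+1)%N) * z ^+ (P - y.+1) * (- q) ^+ (P - y.+1))) =
  q ^ ((h - 1) * P) * ((1 + q^-1) / (1 + q^-1 ^+ P) *
    (z^-1 ^+ y * q^-1 ^ ((h - 1) * y) * (- q^-1) ^+ y)).
Proof.
move=> q0 zP z0 oP yP qP0.
have eq_z : z * z ^+ (P - y.+1) = z^-1 ^+ y.
  rewrite -exprS -subSn// subSS exprVn; apply: (mulIf (expf_neq0 y z0)).
  by rewrite -exprD subnK 1?ltnW// zP mulVf ?expf_neq0.
(* The total exponent is (h-1)P - (h-1)y; its first term is the extra factor in the reflected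
   sum. *)
have eq_q : q ^ (h - 1) * q ^ ((h - 1) * (P - y.+1)%N) =
    q ^ ((h - 1) * P) * q^-1 ^ ((h - 1) * y).
  rewrite exprz_inv -!expfzDr//; congr (q ^ _).
  by rewrite -subzn// -addn1 PoszD; ring.
(* The normalising factors at q and q^-1 differ by q^P / q, which the sign power supplies because P
   is odd. *)
have eq_sign : (1 + q) / (1 + q ^+ P) * (- q) ^+ (P - y.+1) =
    (1 + q^-1) / (1 + q^-1 ^+ P) * (- q^-1) ^+ y.
  have qq : (- q) ^+ (P - y.+1) = q ^+ P / q * (- q^-1) ^+ y.
    apply: (mulIf (expf_neq0 y.+1 (_ : - q != 0))); first by rewrite oppr_eq0.
    rewrite -exprD subnK// exprS mulrACA -exprMn mulrNN mulVf// expr1n mulr1.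
    by rewrite mulrN divfK// exprNn -signr_odd oP mulN1r.
  rewrite qq mulrA; congr (_ * _); rewrite exprVn.
  have -> : 1 + q^-1 = (1 + q) / q by rewrite mulrDl mul1r divff// addrC.
  have -> : 1 + (q ^+ P)^-1 = (1 + q ^+ P) / q ^+ P.
    by rewrite mulrDl mul1r divff ?expf_neq0// addrC.
  by rewrite invf_div; ring.
rewrite [LHS](_ : _ =
  (q ^ (h - 1) * q ^ ((h - 1) * (P - y.+1)%N)) * (z * z ^+ (P - y.+1)) *
  ((1 + q) / (1 + q ^+ P) * (- q) ^+ (P - y.+1))); last by ring.
by rewrite eq_q eq_z eq_sign; ring.
Qed.

(** In 1 + x = 2 + (x - 1) the unit 2 dominates. This gives the normalising factor of the integral
    absolute value 1. *)
Lemma vabs_1D_one_unit (R : realType) (K : ultravaluedFieldType R) (x : K) :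
  vabs (2%:R : K) = 1 -> vabs (x - 1) < 1 -> vabs (1 + x) = 1.
Proof.
move=> v2 x1; have -> : 1 + x = 2%:R + (x - 1) by ring.
by rewrite vabsDl_eq v2.
Qed.

Theorem theorem5 (R : realType) (p : nat) (C : padic_tower R p)
    (q : Cp C) (h : int) (zeta : Cp C) (n : nat) :
  prime p -> odd p -> vabs (q - 1) < 1 -> Tp C zeta ->
  q ^ (h - 1) * zeta *
    fermionic_integral q (fun x : padic_int C =>
      qnum q^-1 (1 - x) ^+ n * padic_pow q ((h - 1)%:~R * x) * padic_pow zeta x)
  = twisted_Euler h n q^-1 zeta^-1 (2%:R : padic_int C).
Proof.
move=> pp op q1 [M /= _ zM].
have p1 : vabs (p%:R : Cp C) < 1.
  by rewrite pmulrn vabs_intr_Cp padic_abs_prime_lt1.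
have v2 : vabs (2%:R : Cp C) = 1.
  rewrite pmulrn vabs_intr_Cp padic_abs_intr /=.
  rewrite (_ : logn p 2 = 0%N) ?expr0 ?invr1//.
  by rewrite lognE pp/= dvdn_prime2// (_ : p == 2 = false)//; case: eqP op => // ->.
have vq : vabs q = 1 := vabs_one_unit q1.
have q0 := vabs_eq1_neq0 vq.
have cq := cvg_one_unit_expp p1 q1; have cqV := cvg_expp_inv pp cq.
have zN N : (M <= N)%N -> zeta ^+ (p ^ N) = 1.
  by move=> MN; rewrite -(subnKC MN) expnD exprM zM expr1n.
have cz : zeta ^+ (p ^ N) @[N --> \oo] --> (1 : Cp C).
  apply/cvg_vabsP => e e0; exists M => // N /= MN.
  by rewrite zN// subrr vabs0.
have vz := cvg_expp_vabs1 pp cz; have z0 := vabs_eq1_neq0 vz.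
have czV := cvg_expp_inv pp cz.
rewrite /twisted_Euler /fermionic_integral -limMl_vabs; last first.
  by rewrite mulf_neq0 ?expfz_neq0.
apply: eq_lim_vabs => e e0; near=> N.
have qPe : vabs (1 - q ^+ (p ^ N)) < e.
  by near: N; move/cvg_vabsP: cq => /(_ e e0).
have qnumPe : vabs (qnum q^-1 ((p ^ N)%N%:~R : padic_int C)) < e.
  by near: N; exact: near_vabs_qnum_expp.
set P := (p ^ N)%N in qPe qnumPe *.
(* Beyond [M] the power zeta^P equals 1 exactly, as the reflection requires. *)
have MN : (M <= N)%N by near: N; exists M.
have oP : odd P by rewrite oddX op orbT.
(* [A] is the left bracket after reflection, since 1 - (P - 1 - y) = 2 + y - P; [B] is the right
   bracket. *)
pose A (y : nat) := qnum q^-1 ((2%:Z + y%:Z - P%:Z)%:~R : padic_int C).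
pose B (y : nat) := qnum q^-1 ((2%:Z + y%:Z)%:~R : padic_int C).
pose c := (1 + q^-1) / (1 + q^-1 ^+ P).
pose w (y : nat) := zeta^-1 ^+ y * q^-1 ^ ((h - 1) * y) * (- q^-1) ^+ y.
have vqV : vabs q^-1 = 1 by rewrite vabsV vq invr1.
have one_unitX (a : Cp C) : vabs (a - 1) < 1 -> vabs (a ^+ P - 1) < 1.
  move=> a1; apply: (le_lt_trans _ a1).
  exact: (vabs_expz_sub1_le P (vabs_one_unit a1)).
have qV1 : vabs (q^-1 - 1) < 1.
  by rewrite (le_lt_trans _ q1)// -exprN1 vabs_expz_sub1_le.
have vc : vabs c = 1.
  rewrite vabsM vabsV (vabs_1D_one_unit v2 qV1).
  by rewrite (vabs_1D_one_unit v2 (one_unitX _ qV1)) invr1 mulr1.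
have vw y : vabs (w y) = 1.
  rewrite !vabsM vabsX_eq1 ?vabsV ?vz ?invr1// vabsXz_eq1// vabsX_eq1 ?vabsN//.
  by rewrite !mul1r.
rewrite [X in vabs (X - _)](_ : _ =
    c * \sum_(0 <= y < P) q ^ ((h - 1) * P) * A y ^+ n * w y); last first.
  rewrite big_nat_rev/= add0n !mulr_sumr; apply: eq_big_nat => y /andP[_ yP].
  have -> : 1 - (P - y.+1)%:R = (2%:Z + y%:Z - P%:Z)%:~R :> padic_int C.
    rewrite natrB// rmorphB rmorphD/= -!pmulrn -natr1; ring.
  rewrite [(P - y.+1)%:R]pmulrn -rmorphM/= !padic_pow_int//.
  have qP0 : 1 + q ^+ P != 0.
    by rewrite vabs_eq1_neq0// vabs_1D_one_unit// one_unitX.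
  have weightE := reflect_weight h q0 (zN _ MN) z0 oP yP qP0.
  rewrite -/c -/(w y) in weightE.
  transitivity (A y ^+ n * (c * (q ^ ((h - 1) * P) * w y))); last by ring.
  rewrite [c * _]mulrCA -weightE -[zeta ^ _]/(zeta ^+ _); ring.
rewrite [X in vabs (_ - X)](_ : _ = c * \sum_(0 <= y < P) B y ^+ n * w y); last first.
  congr (_ * _); apply: eq_big_nat => y _.
  rewrite [y%:R]pmulrn [2%:R]pmulrn -rmorphD -rmorphM/= !padic_pow_int//.
  by rewrite -/(B y) /w !mulrA.
(* As |c| = 1, the ultrametric inequality leaves only a bound on each term, uniform in y, whatever
   the number of terms. *)
rewrite -mulrBr -sumrB vabsM vc mul1r.
pose d := Num.max (vabs (1 - q ^+ P)) (vabs (qnum q^-1 (P%:~R : padic_int C))).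
apply: (@le_lt_trans _ _ d); last first.
  by rewrite gt_max qPe qnumPe.
apply: vabs_sum_le => [|y _]; first by rewrite le_max vabs_ge0.
rewrite -mulrBl vabsM vw mulr1.
(* The two perturbations separate: the extra factor is controlled by |1 - q^P|, the shift by P in
   the bracket by |[P]|. *)
have -> : q ^ ((h - 1) * P) * A y ^+ n - B y ^+ n =
  (q ^ ((h - 1) * P) - 1) * A y ^+ n + (A y ^+ n - B y ^+ n) by ring.
have vA : vabs (A y) <= 1 by exact: vabs_qnum_int_le1.
have vB : vabs (B y) <= 1 by exact: vabs_qnum_int_le1.
apply: vabsD_le; rewrite le_max; apply/orP; [left|right].
  rewrite vabsM (le_trans (ler_piMr _ _)) ?vabs_ge0 ?vabsX ?exprn_ile1 ?vabs_ge0//.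
  rewrite mulrC -exprz_exp vabs_distC [leRHS]vabs_distC vabs_distC.
  by apply: vabs_expz_sub1_le; rewrite vabsX_eq1.
rewrite (le_trans (vabs_subX_le _ vA vB))// /A /B qnum_intB//.
by rewrite vabsM vabsN vabsXz_eq1// mul1r.
Unshelve. all: by end_near. Qed.
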